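(* Let $R$ be an integral domain. The following conditions are equivalent: (i) $R$ is an integrally closed $w$-divisorial $w$-stable domain; (ii) $R$ is a $w$-stable $w$-divisorial P$v$MD; (iii) $R$ is a $w$-divisorial generalized Krull domain; (iv) $R$ is a weakly Matlis $w$-stable P$v$MD; (v) $R$ is a weakly Matlis strongly discrete P$v$MD; (vi) $R$ is a weakly Matlis generalized Krull domain.
   Context: $R$ is an integral domain with quotient field $K\neq R$. For nonzero $R$-submodules $A,B$ of $K$, $(A:B)=\{x\in K: xB\subseteq A\}$; $E(I)=(I:I)$. For a nonzero fractional ideal $I$, $I_v=(R:(R:I))$ ($I$ divisorial if $I=I_v$), $I_t=\bigcup\{J_v: J\subseteq I\text{ nonzero finitely generated}\}$ ($I$ a $t$-ideal if $I=I_t$); $t$-primes are prime $t$-ideals; $t\text{-Max}(R)$ is the set of ideals maximal among proper $t$-ideals. For a nonzero $R$-submodule $E$ of $K$, $E_w=\bigcap_{M\in t\text{-Max}(R)}ER_M$; $I$ is a $w$-ideal if $I=I_w$. $R$ is $w$-divisorial if every $w$-ideal is divisorial. $R$ is $w$-stable if every $w$-ideal $I$ satisfies $(I(E(I):I))_w=E(I)$. $R$ is weakly Matlis if each nonzero element lies in only finitely many $t$-maximal ideals and each $t$-prime is contained in a unique $t$-maximal ideal. $R$ is a P$v$MD if $R_M$ is a valuation domain for each $M\in t\text{-Max}(R)$; a P$v$MD is strongly discrete if $(P^2)_t\neq P$ for each $t$-prime $P$. A generalized Krull domain is a strongly discrete P$v$MD satisfying the ascending chain condition on radical $t$-ideals.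 *)

(* Defs.v *)
From mathcomp Require Import all_boot all_algebra.
Set Implicit Arguments. Unset Strict Implicit. Unset Printing Implicit Defensive.
Import GRing.Theory.
Local Open Scope ring_scope.

Section Defs.
Variable R : idomainType.
Local Notation K := {fraction R}.
Local Notation F := (@FracField.tofrac R).

Definition subK := K -> Prop.

Definition sub (A B : subK) : Prop := forall x, A x -> B x.
Definition seteq (A B : subK) : Prop := forall x, A x <-> B x.

Definition Rset : subK := fun x => exists r : R, x = F r.

Definition submod (E : subK) : Prop :=
  [/\ E 0, (forall x y, E x -> E y -> E (x + y))
         & (forall r x, Rset r -> E x -> E (r * x))].
Definition nonzero (E : subK) : Prop := exists x, x != 0 /\ E x.
Definition nz_submod (E : subK) : Prop := submod E /\ nonzero E.

Definition frac_ideal (I : subK) : Prop :=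
  nz_submod I /\ exists d, [/\ d != 0, Rset d & forall x, I x -> Rset (d * x)].

Definition ideal (I : subK) : Prop := submod I /\ sub I Rset.
Definition proper (I : subK) : Prop := ~ I 1.
Definition prime_ideal (P : subK) : Prop :=
  [/\ ideal P, proper P & forall a b, Rset a -> Rset b -> P (a * b) -> P a \/ P b].

Definition colon (A B : subK) : subK := fun x => forall b, B b -> A (x * b).
Definition Eend (I : subK) : subK := colon I I.

Definition prodK (A B : subK) : subK := fun x =>
  exists s : seq (K * K), (forall p, p \in s -> A p.1 /\ B p.2) /\
    x = \sum_(p <- s) p.1 * p.2.

Definition fin_gen (J : subK) : Prop :=
  exists s : seq K, forall x, J x <->
    exists c : seq R, size c = size s /\ x = \sum_(i < size s) F c`_i * s`_i.

Definition vcl (I : subK) : subK := colon Rset (colon Rset I).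
Definition divisorial (I : subK) : Prop := seteq I (vcl I).
Definition tcl (I : subK) : subK := fun x =>
  exists J, [/\ nz_submod J, fin_gen J, sub J I & vcl J x].
Definition t_ideal (I : subK) : Prop := ideal I /\ nonzero I /\ seteq I (tcl I).
Definition t_prime (P : subK) : Prop := prime_ideal P /\ nonzero P /\ seteq P (tcl P).
Definition t_max (M : subK) : Prop :=
  [/\ t_ideal M, proper M &
      forall N, t_ideal N -> proper N -> sub M N -> sub N M].

Definition loc (E M : subK) : subK := fun x =>
  exists e s, [/\ E e, Rset s, ~ M s & x = e / s].

Definition wcl (E : subK) : subK := fun x => forall M, t_max M -> loc E M x.
Definition w_ideal (I : subK) : Prop := frac_ideal I /\ seteq I (wcl I).

Definition w_divisorial : Prop := forall I, w_ideal I -> divisorial I.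
Definition w_stable : Prop := forall I, w_ideal I ->
  seteq (wcl (prodK I (colon (Eend I) I))) (Eend I).

Definition integrally_closed : Prop := forall x : K,
  (exists p : {poly R}, p \is monic /\ root (map_poly F p) x) -> Rset x.

Definition weakly_Matlis : Prop :=
  (forall x, Rset x -> x != 0 -> exists (n : nat) (f : nat -> subK),
     forall M, t_max M -> M x -> exists i, (i < n)%N /\ seteq M (f i)) /\
  (forall P, t_prime P -> exists M, [/\ t_max M, sub P M &
     forall N, t_max N -> sub P N -> seteq N M]).

Definition valuation_ring (D : subK) : Prop :=
  forall x : K, x != 0 -> D x \/ D x^-1.
Definition PvMD : Prop := forall M, t_max M -> valuation_ring (loc Rset M).

Definition strongly_discrete_PvMD : Prop :=
  PvMD /\ forall P, t_prime P -> ~ seteq (tcl (prodK P P)) P.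

Definition radical_t_ideal (I : subK) : Prop :=
  t_ideal I /\ forall x (n : nat), Rset x -> I (x ^+ n) -> I x.
Definition acc_radical_t : Prop :=
  forall I : nat -> subK, (forall n, radical_t_ideal (I n)) ->
    (forall n, sub (I n) (I n.+1)) ->
    exists n, forall m, (n <= m)%N -> seteq (I m) (I n).

Definition generalized_Krull : Prop := strongly_discrete_PvMD /\ acc_radical_t.

(* standing assumption K <> R *)
Definition not_field : Prop := exists x : K, ~ Rset x.
End Defs.

(* Main.v *)
Require Import Defs.
From mathcomp Require Import all_boot all_algebra.
From mathcomp Require Import ring boolp.
From mathcomp Require classical_sets.
(* Every overring R_M at a t-maximal ideal M is compared through denominators outside M.

   In a weakly Matlis PvMD, distinct t-maximal ideals are independent: for h <> 0 some r
   outside M lies in h R_N for all N <> M, so a property of a fractional w-ideal can be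
   arranged at M alone while it is trivial elsewhere. Strong discreteness makes I R_M
   principal over its endomorphism ring, which gives w-stability, and makes the maximal
   ideal of R_M principal, which gives w-divisoriality; a generator of the prime
   under the union of a chain of radical t-ideals stops the chain at M, and only the
   finitely many M containing a fixed nonzero element matter.

   Conversely, let R be w-divisorial and x <> 0 in R. If an intersection of modules of the
   form {y | x y in R, y in R_N for N in S} equals R, then finitely many elements of their
   duals have t-closure R. Applied to S = {M} for the M containing x, this bounds the
   number of these M; applied to S = {M} and its complement, with x in a t-prime
   inside both M and some N <> M, it puts 1 into the t-closure of M.
   If P = (P^2)_t is a t-prime contained in M, w-stability gives a in P and u outside M with
   u P^2 contained in a P, so a lies in a P R_M, which is absurd. Finally, for R integrally
   closed and w-stable, (1, x)_w has endomorphism ring R by the 2x2 determinant trick, so it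
   is w-invertible, and x or 1/x lies in R_M. *)

Set Implicit Arguments. Unset Strict Implicit. Unset Printing Implicit Defensive.
Import GRing.Theory.
Local Open Scope ring_scope.
Local Open Scope quotient_scope.

(** * Fractions, t-closure and existence of t-maximal ideals *)

Section StarOperations.
Variable R : idomainType.
Local Notation K := {fraction R}.
Local Notation F := (@FracField.tofrac R).
Local Notation Rs := (@Rset R).
Local Notation proper := (@Defs.proper R).
Implicit Types (A B E G I J M N P : subK R) (x y a b c r : K).

Lemma Rset0 : Rs 0. Proof. by exists 0; rewrite rmorph0. Qed.
Lemma Rset1 : Rs 1. Proof. by exists 1; rewrite rmorph1. Qed.
Lemma RsetD x y : Rs x -> Rs y -> Rs (x + y).
Proof. by move=> [a ->] [b ->]; exists (a + b); rewrite rmorphD. Qed.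
Lemma RsetM x y : Rs x -> Rs y -> Rs (x * y).
Proof. by move=> [a ->] [b ->]; exists (a * b); rewrite rmorphM. Qed.
Lemma RsetN x : Rs x -> Rs (- x).
Proof. by move=> [a ->]; exists (- a); rewrite rmorphN. Qed.

Lemma frac_mul_neq0 x y : x != 0 -> y != 0 -> x * y != 0.
Proof. exact: mulf_neq0. Qed.

Lemma denominator x : exists b, [/\ b != 0, Rs b & Rs (b * x)].
Proof.
elim/quotW: x => q; exists (F \d_q); rewrite tofrac_eq0 denom_ratioP.
split=> //; [by exists \d_q | exists \n_q].
unlock FracField.tofrac; rewrite -[LHS]FracField.pi_mul; apply/eqmodP.
rewrite /= FracField.equivfE /FracField.mulf /= !numden_Ratio ?mulf_neq0 ?oner_eq0 ?denom_ratioP //.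
by rewrite mulr1 mul1r mulrC.
Qed.

(* Agrees with [tcl] on nonzero submodules ([tcl_tclosure]), but makes sense for an
   arbitrary set [G] of generators. *)
Definition tclosure G : subK R := fun x => exists s : seq K,
  (forall a, a \in s -> G a) /\
  (forall y, (forall a, a \in s -> Rs (y * a)) -> Rs (x * y)).

Definition tclosed I := sub (tclosure I) I.

Lemma tclosure_sub G : sub G (tclosure G).
Proof.
move=> x Gx; exists [:: x]; split=> [a|y]; first by rewrite inE => /eqP->.
by move/(_ x); rewrite mulrC inE; exact.
Qed.

Lemma tclosureS A B : sub A B -> sub (tclosure A) (tclosure B).
Proof. by move=> AB x [s [sA sx]]; exists s; split=> // a /sA /AB. Qed.

(** Each entry of the outer list needs only finitely many elements of [G]; the concatenation of
    these lists serves for [x]. *)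
Lemma tclosureK G : tclosed (tclosure G).
Proof.
move=> x [s [sG sx]].
suff [u [uG su]] : exists u : seq K, (forall a, a \in u -> G a) /\
    forall y, (forall a, a \in u -> Rs (y * a)) -> forall a, a \in s -> Rs (y * a).
  by exists u; split=> // y /su /sx.
elim: s sG {sx} => [|b s IH] sG; first by exists [::].
have [u [uG us]] := IH (fun a sa => sG a (mem_behead (s := b :: s) sa)).
have [v [vG vb]] := sG b (mem_head _ _).
exists (v ++ u); split=> [a|y yvu a]; first by rewrite mem_cat => /orP[/vG|/uG].
rewrite inE => /orP[/eqP->|sa].
  by rewrite mulrC; apply: vb => c vc; apply: yvu; rewrite mem_cat vc.
by apply: us sa => c uc; apply: yvu; rewrite mem_cat uc orbT.
Qed.

Lemma tclosed_submod I : tclosed I -> submod I.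
Proof.
move=> cI; split.
- by apply: cI; exists [::]; split=> // y _; rewrite mul0r; apply: Rset0.
- move=> x y Ix Iy; apply: cI; exists [:: x; y]; split=> [a|z zs].
    by rewrite !inE => /orP[] /eqP->.
  by rewrite mulrDl ![_ * z]mulrC; apply: RsetD; apply: zs; rewrite !inE eqxx ?orbT.
- move=> r x Rr Ix; apply: cI; exists [:: x]; split=> [a|z zs].
    by rewrite inE => /eqP->.
  by rewrite -mulrA; apply: RsetM=> //; rewrite mulrC; apply: zs; rewrite inE.
Qed.

Lemma tclosed_preim I a : tclosed I -> tclosed (fun x => I (x * a)).
Proof.
move=> cI x [s [sI sx]]; apply: cI; exists [seq b * a | b <- s].
split=> [_ /mapP[b /sI Ib ->] //|y ys].
rewrite -mulrA; apply: sx => b sb; rewrite [a * y]mulrC -mulrA [a * b]mulrC.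
by apply: ys; apply: map_f.
Qed.

Definition span (s : seq K) : subK R := fun x => exists c : seq R,
  size c = size s /\ x = \sum_(i < size s) F c`_i * s`_i.

Lemma span_submod s : submod (span s).
Proof.
split.
- exists (nseq (size s) 0); rewrite size_nseq; split=> //.
  by rewrite big1 // => i _; rewrite nth_nseq ltn_ord rmorph0 mul0r.
- move=> x y [c [sc ->]] [d [sd ->]].
  exists (mkseq (fun i => c`_i + d`_i) (size s)); rewrite size_mkseq; split=> //.
  by rewrite -big_split /=; apply: eq_bigr => i _; rewrite nth_mkseq // rmorphD mulrDl.
- move=> _ x [r ->] [c [sc ->]].
  exists (mkseq (fun i => r * c`_i) (size s)); rewrite size_mkseq; split=> //.
  by rewrite mulr_sumr; apply: eq_bigr => i _; rewrite nth_mkseq // rmorphM mulrA.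
Qed.

Lemma mem_span s x : x \in s -> span s x.
Proof.
move=> sx; exists (mkseq (fun i => (i == index x s)%:R) (size s)).
rewrite size_mkseq; split=> //; have lx : (index x s < size s)%N by rewrite index_mem.
rewrite (bigD1 (Ordinal lx)) //= nth_mkseq // eqxx rmorph1 mul1r nth_index //.
rewrite big1 ?addr0 // => i ix; rewrite nth_mkseq //.
case: eqP => [ii|]; last by rewrite rmorph0 mul0r.
by case/eqP: ix; apply: val_inj.
Qed.

Lemma submod_sum I (T : Type) (s : seq T) (P : pred T) (f : T -> K) :
  submod I -> (forall i, P i -> I (f i)) -> I (\sum_(i <- s | P i) f i).
Proof. by move=> [I0 ID _] If; apply: big_ind. Qed.

Lemma span_sub I (s : seq K) : submod I -> (forall a, a \in s -> I a) -> sub (span s) I.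
Proof.
move=> mI sI x [c [sc ->]]; apply: submod_sum => // i _.
case: mI => _ _; apply; first by exists c`_i.
by apply: sI; apply: mem_nth.
Qed.

Lemma tcl_tclosure I : nz_submod I -> seteq (tcl I) (tclosure I).
Proof.
move=> [mI [z [z0 Iz]]] x; split.
  move=> [J [_ [s sJ] JI Jx]]; exists s; split=> [a /mem_span sa|y ys].
    by apply: JI; apply/sJ.
  by apply: Jx => b /sJ; apply: (@span_sub (fun b => Rs (y * b))) => {b}; first split;
    [rewrite mulr0; apply: Rset0 | move=> b c; rewrite mulrDr; apply: RsetD
    | move=> r b Rr; rewrite mulrCA; apply: RsetM | ].
(* [tcl] asks for a nonzero submodule, while [s] may be empty or zero; hence the extra [z]. *)
move=> [s [sI sx]]; exists (span (z :: s)); split.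
- split; first exact: span_submod.
  by exists z; split=> //; apply: mem_span; apply: mem_head.
- by exists (z :: s).
- by apply: span_sub => // a; rewrite inE => /orP[/eqP->|/sI].
- by move=> y sy; apply: sx => a sa; apply: sy; apply: mem_span; rewrite inE sa orbT.
Qed.

Lemma seteq_eq A B : seteq A B -> A = B.
Proof. by move=> AB; apply: funext => x; apply: propext. Qed.

Lemma t_idealP I : t_ideal I <-> [/\ sub I Rs, nonzero I & tclosed I].
Proof.
split=> [[[mI IR] [nI /seteq_eq cI]]|[IR nI cI]].
  split=> // x /tcl_tclosure; rewrite -cI; apply; split=> //.
have mI := tclosed_submod cI; split; [by []|split=> // x].
rewrite (tcl_tclosure (conj mI nI) x); split=> [|/cI //].
exact: tclosure_sub.
Qed.

Lemma Rset_tclosed : tclosed Rs.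
Proof.
move=> x [s [sR sx]]; rewrite -[x]mulr1; apply: sx => a /sR.
by rewrite mul1r.
Qed.

Lemma tclosedI A B : tclosed A -> tclosed B -> tclosed (fun x => A x /\ B x).
Proof.
move=> cA cB x xAB; split; [apply: cA | apply: cB]; move: x xAB;
  by apply: tclosureS => x [].
Qed.

Lemma t_max_exists I : t_ideal I -> proper I -> exists M, t_max M /\ sub I M.
Proof.
move=> /t_idealP[IR nI cI] pI.
(* The empty chain has empty union, so [U] adjoins [I] instead of requiring that [X] contain it. *)
pose U X : subK R := fun x => X x \/ I x.
pose good X := [/\ tclosed (U X), sub (U X) Rs & proper (U X)].
have [|A [[cA AR pA] Amax]] := classical_sets.Zorn_bigcup (P := good).
  move=> C Cgood Ctot; set B := classical_sets.bigcup _ _.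
  split; last by case=> // -[X CX X1]; have [_ _] := Cgood X CX; apply; left.
    move=> x [s [sU sx]].
    have [sI|[X [CX sX]]] : (forall a, a \in s -> I a) \/
        exists X, C X /\ forall a, a \in s -> U X a.
    - elim: s sU {sx} => [|b s IH] sU; first by left.
      have {IH} IH := IH (fun a sa => sU a (mem_behead (s := b :: s) sa)).
      have [[Y CY Yb]|Ib] := sU b (mem_head _ _).
        case: IH => [sI|[X [CX sX]]].
          right; exists Y; split=> // a; rewrite inE => /orP[/eqP->|/sI]; first by left.
          by right.
        case: (Ctot X Y CX CY) => XY; right.
          exists Y; split=> // a; rewrite inE => /orP[/eqP->|/sX[/XY|]]; [by left|by left|by right].
        exists X; split=> // a; rewrite inE => /orP[/eqP->|/sX //]; by left; apply: XY.
      case: IH => [sI|[X [CX sX]]].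
        by left=> a; rewrite inE => /orP[/eqP->|/sI].
      by right; exists X; split=> // a; rewrite inE => /orP[/eqP->|/sX //]; right.
    - by right; apply: cI; exists s.
    - have [cX _ _] := Cgood X CX.
      have [Xx|] : U X x by apply: cX; exists s.
        by left; exists X.
      by right.
  by move=> x [[X CX Xx]|/IR //]; have [_ XR _] := Cgood X CX; apply: XR; left.
have UI : sub I (U A) by move=> x; right.
exists (U A); split=> //; split=> //.
  apply/t_idealP; split=> //; have [z [z0 Iz]] := nI.
  by exists z; split=> //; apply: UI.
move=> N /t_idealP[NR _ cN] pN AN x Nx; apply: contrapT => nAx.
have UN : U N = N by apply: seteq_eq => y; split=> [[//|/UI/AN]|]; last by left.
case: (Amax N); last by rewrite /good UN.
by split=> [y Ay|/(_ x Nx) Ax]; [apply: AN; left | apply: nAx; left].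
Qed.

(** * Localization at a t-maximal ideal *)

Section Maximal.
Variable M : subK R.
Hypothesis tM : t_max M.

Lemma t_max_props : [/\ sub M Rs, nonzero M & tclosed M].
Proof. by case: tM => /t_idealP. Qed.

Lemma t_max_submod : submod M.
Proof. by case: t_max_props => _ _ /tclosed_submod. Qed.

Lemma t_max_adjoin a : Rs a -> ~ M a -> tclosure (fun x => M x \/ x = a) 1.
Proof.
case: tM => tiM pM Mmax; case: t_max_props => MR [z [z0 Mz]] cM Ra nMa.
apply: contrapT => n1; apply: nMa; apply: (Mmax (tclosure (fun x => M x \/ x = a))) => //.
- apply/t_idealP; split; last exact: tclosureK.
    move=> x /(tclosureS (B := Rs)) xR; apply: Rset_tclosed; apply: xR.
    by move=> y [/MR|->].
  by exists z; split=> //; apply: tclosure_sub; left.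
- by move=> x Mx; apply: tclosure_sub; left.
- by apply: tclosure_sub; right.
Qed.

(** Adjoining [a] or [b] to [M] puts 1 into the t-closure. The products of the two witnessing lists
    lie in [M] and would put 1 into [M]. *)
Lemma t_max_prime : prime_ideal M.
Proof.
case: t_max_props => MR nM cM; have mM := t_max_submod.
case: tM => _ pM _; split=> // a b Ra Rb Mab.
apply: contrapT => /not_orP[nMa nMb].
have [s [sM s1]] := t_max_adjoin Ra nMa; have [u [uM u1]] := t_max_adjoin Rb nMb.
case: mM => _ _ MM; apply: pM; apply: cM.
exists [seq x * y | x <- s, y <- u]; split.
  move=> _ /allpairsP[[x y] /= [/sM xM /uM yM ->]].
  case: xM yM => [Mx [My|->]|-> [My|-> //]]; last exact: MM.
    by apply: MM => //; apply: MR.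
  by rewrite mulrC; apply: MM.
move=> y ys; apply: s1 => c sc; rewrite -[_ * c]mul1r; apply: u1 => d ud.
by rewrite -mulrA; apply: ys; apply: allpairs_f.
Qed.

Definition out r := Rs r /\ ~ M r.

Lemma out1 : out 1.
Proof. by split; [apply: Rset1 | case: tM]. Qed.

Lemma outM a b : out a -> out b -> out (a * b).
Proof.
move=> [Ra nMa] [Rb nMb]; split; first exact: RsetM.
by case: t_max_prime => _ _ MP /MP[].
Qed.

Lemma out_neq0 r : out r -> r != 0.
Proof.
move=> [_ nMr]; apply/eqP => r0; apply: nMr; rewrite r0.
by case: t_max_submod.
Qed.

Lemma loc_outP E x : loc E M x <-> exists r, out r /\ E (r * x).
Proof.
split=> [[e [r [Ee Rr nMr ->]]]|[r [or Erx]]].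
  by exists r; split=> //; rewrite mulrC mulfVK ?out_neq0.
exists (r * x), r; case: (or) => Rr nMr; split=> //.
by rewrite mulrAC mulfV ?mul1r ?out_neq0.
Qed.

Lemma loc_sub E : sub E (loc E M).
Proof. by move=> x Ex; apply/loc_outP; exists 1; rewrite mul1r; split=> //; apply: out1. Qed.

Lemma locS A B : sub A B -> sub (loc A M) (loc B M).
Proof. by move=> AB x /loc_outP[r [or /AB Brx]]; apply/loc_outP; exists r. Qed.

Lemma locK E : sub (loc (loc E M) M) (loc E M).
Proof.
move=> x /loc_outP[r [or /loc_outP[u [ou Eux]]]]; apply/loc_outP.
by exists (u * r); rewrite -mulrA; split=> //; apply: outM.
Qed.

Lemma loc_mul A B E x y : (forall a b, A a -> B b -> E (a * b)) ->
  loc A M x -> loc B M y -> loc E M (x * y).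
Proof.
move=> AB /loc_outP[r [or Arx]] /loc_outP[u [ou Buy]]; apply/loc_outP.
by exists (r * u); rewrite mulrACA; split; [apply: outM | apply: AB].
Qed.

Lemma loc_submod E : submod E -> submod (loc E M).
Proof.
move=> [E0 ED EM]; split; first exact: loc_sub.
  move=> x y /loc_outP[r [or Ex]] /loc_outP[u [ou Ey]]; apply/loc_outP.
  exists (r * u); split; first exact: outM.
  rewrite mulrDr {1}[r * u]mulrC -!mulrA.
  by apply: ED; apply: EM => //; [case: ou | case: or].
move=> r x Rr Ex; apply: (loc_mul (A := Rs) (B := E)) => //; exact: loc_sub.
Qed.

Lemma loc_RsetM E x y : submod E -> loc Rs M x -> loc E M y -> loc E M (x * y).
Proof. by move=> [_ _ EM]; apply: loc_mul. Qed.

Lemma out_unit r : out r -> loc Rs M r^-1.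
Proof.
move=> or; apply/loc_outP; exists r; split=> //.
by rewrite mulfV ?out_neq0 //; apply: Rset1.
Qed.

(* [dvd_at x y] says that [x] lies in the principal submodule [y R_M]. *)
Definition dvd_at x y := exists u r, [/\ out u, Rs r & u * x = r * y].

Lemma dvd_at_trans x y z : dvd_at x y -> dvd_at y z -> dvd_at x z.
Proof.
move=> [u [r [ou Rr e]]] [v [t [ov Rt f]]]; exists (v * u), (r * t).
split; [exact: outM | exact: RsetM|].
by rewrite -mulrA e mulrCA f mulrA.
Qed.

Lemma dvd_atD x y z : dvd_at x z -> dvd_at y z -> dvd_at (x + y) z.
Proof.
move=> [u [r [ou Rr e]]] [v [t [ov Rt f]]]; exists (u * v), (v * r + u * t).
split; [exact: outM | by case: ou => ? _; case: ov => ? _; apply: RsetD; apply: RsetM|].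
by rewrite mulrDr mulrDl -!mulrA -e -f [v * (u * x)]mulrCA.
Qed.

Lemma dvd_at_total : PvMD R -> forall x y, dvd_at x y \/ dvd_at y x.
Proof.
move=> /(_ M tM) VM x y.
have triv z : dvd_at 0 z.
  by exists 1, 0; rewrite mulr0 mul0r; split=> //; [apply: out1 | apply: Rset0].
have [->|y0] := eqVneq y 0; first by right.
have [->|x0] := eqVneq x 0; first by left.
have div a b : b != 0 -> loc Rs M (a / b) -> dvd_at a b.
  move=> b0 /loc_outP[r [or Rr]]; exists r, (r * (a / b)); split=> //.
  by rewrite -mulrA mulfVK.
have [|xy|] := VM (x / y); first by rewrite mulf_neq0 ?invr_eq0.
  by left; apply: div.
by rewrite invf_div => yx; right; apply: div.
Qed.

Lemma dvd_at_loc E x y : submod E -> dvd_at x y -> E y -> loc E M x.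
Proof.
move=> [_ _ EM] [u [r [ou Rr e]]] Ey; apply/loc_outP; exists u; split=> //.
by rewrite e; apply: EM.
Qed.

(** Totality of divisibility selects the generator by induction, with one denominator [u] for all
    entries. The value 0 covers the empty list. *)
Lemma fin_principal_at (s : seq K) : PvMD R -> exists a, (a = 0 \/ a \in s) /\
  exists u, out u /\ forall b, b \in s -> exists2 r, Rs r & u * b = r * a.
Proof.
move=> pv; elim: s => [|b s [a [sa [u [ou us]]]]].
  by exists 0; split; [left | exists 1; split=> //; apply: out1].
have [[v [r [ov Rr e]]]|[v [r [ov Rr e]]]] := dvd_at_total pv b a.
  exists a; split; first by case: sa => [|sa]; [left | right; rewrite inE sa orbT].
  exists (u * v); split; first exact: outM.
  move=> c; rewrite inE => /orP[/eqP->|/us[t Rt f]].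
    exists (u * r); first by apply: RsetM => //; case: ou.
    by rewrite -!mulrA e.
  exists (v * t); first by apply: RsetM => //; case: ov.
  by rewrite [u * v]mulrC -!mulrA f.
exists b; split; first by right; apply: mem_head.
exists (u * v); split; first exact: outM.
move=> c; rewrite inE => /orP[/eqP->|/us[t Rt f]].
  by exists (u * v) => //; apply: RsetM; [case: ou | case: ov].
exists (t * r); first exact: RsetM.
by rewrite [u * v]mulrC -!mulrA f mulrCA e.
Qed.

(** Locally the list behind [x] has one generator [a], so [u / a] carries the list into R, hence
    also [x]; multiplying back by [a] lands in [I]. *)
Lemma tclosure_loc I x : not_field R -> PvMD R -> submod I -> tclosure I x -> loc I M x.
Proof.
move=> [k nRk] pv mI [s [sI sx]].
have [a [sa [u [ou us]]]] := fin_principal_at s pv.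
have [x0|x0] := eqVneq x 0; first by rewrite x0; apply: loc_sub; case: mI.
(* With [a = 0] the list vanishes, so [x] times all of K lies in R, forcing K = R. *)
have [a0|a0] := eqVneq a 0.
  case: nRk; rewrite -[k](mulVKf x0); apply: sx => b /us[r _].
  move=> /eqP; rewrite a0 mulr0 mulf_eq0 (negPf (out_neq0 ou)) /= => /eqP->.
  by rewrite mulr0; apply: Rset0.
have Ia : I a by case: sa => [e|/sI //]; rewrite e eqxx in a0.
apply/loc_outP; exists u; split=> //.
have -> : u * x = x * (u / a) * a by rewrite -mulrA mulfVK // mulrC.
case: mI => _ _; apply=> //; apply: sx => b /us[r Rr e].
by rewrite mulrAC e mulfK.
Qed.

End Maximal.

(** * The w-closure *)

Lemma wcl_tclosed I : tclosed I -> nonzero I -> sub (wcl I) I.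
Proof.
move=> cI [a [a0 Ia]] x wx; have [_ _ IM] := tclosed_submod cI.
(* The conductor of [x] into [I] is a t-ideal; if proper it lies in some t-maximal [M], yet [x] has
   a denominator outside [M]. *)
pose H : subK R := fun r => Rs r /\ I (r * x).
have tH : t_ideal H.
  apply/t_idealP; split=> [r [] //||]; last first.
    by apply: tclosedI; [apply: Rset_tclosed | apply: tclosed_preim].
  have [b [b0 Rb Rbx]] := denominator x; have [c [c0 Rc Rca]] := denominator a.
  exists (b * (c * a)); split; first by do 2?apply: frac_mul_neq0.
  split; first exact: RsetM.
  by rewrite mulrAC mulrA; apply: IM => //; apply: RsetM.
have [H1|nH1] := EM (H 1); first by case: H1; rewrite mul1r.
have [M [tM HM]] := t_max_exists tH nH1.
have /(loc_outP tM)[r [[Rr nMr] Irx]] := wx M tM.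
by case: nMr; apply: HM.
Qed.

Lemma Rset_wcl : sub (wcl Rs) Rs.
Proof.
apply: wcl_tclosed; first exact: Rset_tclosed.
by exists 1; split; [apply: oner_neq0 | apply: Rset1].
Qed.

Lemma wcl_sub E : sub E (wcl E).
Proof. by move=> x Ex M tM; apply: loc_sub. Qed.

Lemma wclS A B : sub A B -> sub (wcl A) (wcl B).
Proof. by move=> AB x wx M tM; apply: locS (wx M tM). Qed.

Lemma wclK E : sub (wcl (wcl E)) (wcl E).
Proof.
move=> x wx M tM; apply: locK => //; apply: locS (wx M tM) => // y; exact.
Qed.

Lemma wcl_submod E : submod E -> submod (wcl E).
Proof.
move=> mE; have lE M (tM : t_max M) := loc_submod tM mE.
split=> [M tM|x y xE yE M tM|r x Rr xE M tM]; have [E0 ED EM] := lE M tM => //.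
  by apply: ED; [apply: xE | apply: yE].
by apply: EM => //; apply: xE.
Qed.

Lemma tclosed_w_ideal I d : tclosed I -> nonzero I -> d != 0 -> Rs d ->
  (forall x, I x -> Rs (d * x)) -> w_ideal I.
Proof.
move=> cI nI d0 Rd dI; split; first by split; [split=> //; apply: tclosed_submod | exists d].
by move=> x; split; [apply: wcl_sub | apply: wcl_tclosed].
Qed.

Lemma t_ideal_w_ideal I : t_ideal I -> w_ideal I.
Proof.
case/t_idealP => IR nI cI; apply: (@tclosed_w_ideal _ 1) => //.
- exact: oner_neq0.
- exact: Rset1.
- by move=> x /IR; rewrite mul1r.
Qed.

(** * Weakly Matlis PvMDs *)

Lemma prodK_mul A B a b : A a -> B b -> prodK A B (a * b).
Proof.
move=> Aa Bb; exists [:: (a, b)]; split; last by rewrite big_seq1.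
by move=> p; rewrite inE => /eqP->.
Qed.

Lemma prodK_submod A B : submod A -> submod (prodK A B).
Proof.
move=> [_ _ AM]; split; first by exists [::]; rewrite big_nil.
  move=> x y [s [sAB ->]] [u [uAB ->]]; exists (s ++ u); rewrite big_cat; split=> // p.
  by rewrite mem_cat => /orP[/sAB|/uAB].
move=> r x Rr [s [sAB ->]]; exists [seq (r * p.1, p.2) | p <- s].
split=> [_ /mapP[p /sAB[Ap Bp] ->]|]; first by split=> //; apply: AM.
by rewrite big_map mulr_sumr; apply: eq_bigr => p _; rewrite mulrA.
Qed.

Lemma prodK_sub A B E : submod E -> (forall a b, A a -> B b -> E (a * b)) -> sub (prodK A B) E.
Proof.
move=> mE ABE x [s [sAB ->]]; rewrite big_seq; apply: submod_sum => // p /sAB[Ap Bp].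
exact: ABE.
Qed.

Lemma t_prime_ideal P : t_prime P -> t_ideal P /\ proper P.
Proof. by case=> [[iP pP _] [nP cP]]. Qed.

(** The t-closure of [P] lies in [P R_M], whose elements in R belong to [P] because denominators
    avoid [M], hence [P]. *)
Lemma t_prime_intro P M : not_field R -> PvMD R -> t_max M ->
  prime_ideal P -> nonzero P -> sub P M -> t_prime P.
Proof.
move=> nf pv tM pP nP PM; case: (pP) => [[mP PR] propP PP].
suff cP : tclosed P.
  by case: (proj2 (t_idealP P) (And3 PR nP cP)).
move=> x cx; have Rx : Rs x by apply: Rset_tclosed; apply: tclosureS cx.
have /(loc_outP tM)[r [[Rr nMr] Prx]] := tclosure_loc tM nf pv mP cx.
by case: (PP r x) => // /PM.
Qed.

Definition finite_t_char x := exists (n : nat) (f : nat -> subK R),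
  forall M, t_max M -> M x -> exists i, (i < n)%N /\ seteq M (f i).

(** A local-to-global device: choices made at one t-maximal ideal at a time are merged along the
    finite list of ideals containing [x]. *)
Lemma finite_select (T : Type) (good : T -> Prop) (Q : subK R -> T -> Prop) x :
  finite_t_char x -> (exists t, good t) ->
  (forall t u, good t -> good u ->
    exists v, good v /\ forall N, t_max N -> Q N t \/ Q N u -> Q N v) ->
  (forall N, t_max N -> N x -> exists t, good t /\ Q N t) ->
  exists t, good t /\ forall N, t_max N -> N x -> Q N t.
Proof.
move=> [n [f nf]] [t0 gt0] join sel.
suff [t [gt Qt]] : exists t, good t /\
    forall N i, t_max N -> N x -> (i < n)%N -> seteq N (f i) -> Q N t.
  by exists t; split=> // N tN Nx; have [i [ii Ni]] := nf N tN Nx; apply: (Qt N i).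
elim: n {nf} => [|n [t [gt Qt]]]; first by exists t0.
have [[tn nx]|nfn] := EM (t_max (f n) /\ f n x).
  have [u [gu Qu]] := sel _ tn nx; have [v [gv Qv]] := join t u gt gu.
  exists v; split=> // N i tN Nx; rewrite ltnS leq_eqVlt => /orP[/eqP->|ii] Ni; apply: Qv => //.
    by right; rewrite (seteq_eq Ni).
  by left; apply: (Qt N i).
exists t; split=> // N i tN Nx; rewrite ltnS leq_eqVlt => /orP[/eqP->|ii] Ni.
  by case: nfn; rewrite -(seteq_eq Ni).
exact: (Qt N i).
Qed.

Lemma t_max_not_sub M N : t_max M -> t_max N -> ~ seteq N M -> exists r, [/\ Rs r, N r & ~ M r].
Proof.
move=> tM tN NM; apply: contrapT => none; apply: NM => x.
have NM : sub N M.
  move=> y Ny; apply: contrapT => nMy; apply: none; exists y; split=> //.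
  by have [NR _ _] := t_max_props tN; apply: NR.
split; first exact: NM.
by case: tN => _ _; apply=> //; case: tM.
Qed.

Section Separation.
Hypothesis nf : not_field R.
Hypothesis pv : PvMD R.
Hypothesis wm : weakly_Matlis R.

(* If no such [r] existed, the elements [x] admitting none would form a nonzero
   prime ideal contained in both [M] and [N]. *)
Lemma t_max_independent M N a : t_max M -> t_max N -> ~ seteq N M -> Rs a -> a != 0 ->
  exists r, out M r /\ dvd_at N r a.
Proof.
move=> tM tN nNM Ra a0; apply: contrapT => none.
pose P : subK R := fun x => Rs x /\ forall r, out M r -> ~ dvd_at N r x.
have Pa : P a by split=> // r or nr; apply: none; exists r.
have PM : sub P M.
  move=> x [Rx Px]; apply: contrapT => nMx; apply: (Px x) => //.
  by exists 1, 1; split=> //; [apply: out1 | apply: Rset1].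
have PN : sub P N.
  move=> x [Rx Px]; apply: contrapT => nNx; apply: (Px 1); first exact: out1.
  by exists x, 1; rewrite mulrC; split=> //; apply: Rset1.
have pP : prime_ideal P.
  split; [split; [split|by move=> x []]| |].
  - split=> [|r or [u [t [ou _ /eqP]]]]; first exact: Rset0.
    by rewrite mulr0 mulf_eq0 (negPf (out_neq0 tM or)) (negPf (out_neq0 tN ou)).
  - move=> x y [Rx Px] [Ry Py]; split=> [|r or]; first exact: RsetD.
    move=> rxy; have refl z : dvd_at N z z.
      by exists 1, 1; split=> //; [apply: out1 | apply: Rset1].
    have [xy|yx] := dvd_at_total tN pv x y.
      by apply: (Py r or); apply: (dvd_at_trans tN rxy); apply: dvd_atD.
    by apply: (Px r or); apply: (dvd_at_trans tN rxy); apply: dvd_atD.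
  - move=> b x Rb [Rx Px]; split=> [|r or [u [t [ou Rt e]]]]; first exact: RsetM.
    by apply: (Px r or); exists u, (t * b); split=> //; [apply: RsetM | rewrite e mulrA].
  - by move=> /PM; case: tM.
  - move=> x y Rx Ry [_ Pxy]; apply: contrapT => /not_orP[nPx nPy].
    have get z : Rs z -> ~ P z -> exists r, out M r /\ dvd_at N r z.
      move=> Rz nPz; apply: contrapT => nz; apply: nPz; split=> // r or rz.
      by apply: nz; exists r.
    have [r [or [u [c [ou Rc e]]]]] := get x Rx nPx.
    have [t [ot [v [d [ov Rd f]]]]] := get y Ry nPy.
    apply: (Pxy (r * t)); first exact: outM.
    exists (u * v), (c * d); split; [exact: outM | exact: RsetM|].
    by rewrite mulrACA e f mulrACA.
have tP : t_prime P by apply: (t_prime_intro nf pv tM) => //; exists a.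
have [L [tL _ Lu]] := wm.2 P tP.
have := Lu M tM PM; have := Lu N tN PN => /seteq_eq NL /seteq_eq ML.
by apply: nNM; rewrite NL ML.
Qed.

(** A product of elements from [t_max_independent] handles the finitely many [N] containing [h]; at
    any other [N], [h] is a unit. *)
Lemma t_max_separate M h : t_max M -> Rs h -> h != 0 ->
  exists r, out M r /\ forall N, t_max N -> ~ seteq N M -> dvd_at N r h.
Proof.
move=> tM Rh h0.
have [||||r [or sr]] := @finite_select K (out M)
  (fun N r => ~ seteq N M -> dvd_at N r h) h.
- exact: wm.1.
- by exists 1; apply: out1.
- move=> r t or ot; exists (r * t); split=> [|N tN]; first exact: outM.
  case=> rh nNM; have [u [c [ou Rc e]]] := rh nNM.
    exists u, (c * t); split=> //; first by apply: RsetM => //; case: ot.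
    by rewrite mulrA e mulrAC.
  exists u, (r * c); split=> //; first by apply: RsetM => //; case: or.
  by rewrite mulrCA e mulrA.
- move=> N tN Nh; have [NM|nNM] := EM (seteq N M).
    by exists 1; split=> //; apply: out1.
  by have [r [or rh]] := t_max_independent tM tN nNM Rh h0; exists r.
exists r; split=> // N tN nNM; have [Nh|nNh] := EM (N h); first exact: sr.
by exists h, r; rewrite mulrC; split=> //; case: or.
Qed.

(** Some [q] in [P] is outside [P^2 R_N] for a t-maximal [N]. This forces [P] into [N], so [N = M].
    If [u q = r y] with [u] outside [M], then [r] is outside [P] and serves as a denominator at
    [P]. *)
Lemma t_prime_generator P M : strongly_discrete_PvMD R -> t_prime P -> t_max M -> sub P M ->
  exists q, P q /\ forall y, P y -> dvd_at P y q.
Proof.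
move=> [_ sd] tP tM PM; have [tiP pP] := t_prime_ideal tP.
have [PR [z [z0 Pz]] cP] := proj1 (t_idealP P) tiP; have mP := tclosed_submod cP.
case: (tP) => [[_ _ PP] _].
have P2P : sub (prodK P P) P.
  by apply: prodK_sub => // a b /PR Ra; case: mP => _ _; apply.
have nP2 : nz_submod (prodK P P).
  split; first exact: prodK_submod.
  by exists (z * z); split; [apply: frac_mul_neq0 | apply: prodK_mul].
have [q [Pq nq]] : exists q, P q /\ ~ tclosure (prodK P P) q.
  apply: contrapT => none; apply: (sd P tP) => x; rewrite (tcl_tclosure nP2).
  split=> [/(tclosureS P2P)/cP //|Px]; apply: contrapT => nx.
  by apply: none; exists x.
have [N [tN nNq]] : exists N, t_max N /\ ~ loc (prodK P P) N q.
  apply: contrapT => none; apply: nq; apply: wcl_tclosed.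
  - exact: tclosureK.
  - by case: nP2 => _ [x [x0 xP]]; exists x; split=> //; apply: tclosure_sub.
  - apply: (wclS (@tclosure_sub _)) => N tN; apply: contrapT => nN.
    by apply: none; exists N.
have PN : sub P N.
  move=> p Pp; apply: contrapT => nNp; apply: nNq; apply/(loc_outP tN).
  have op : out N p by split=> //; apply: PR.
  exists (p * p); split; first exact: outM.
  rewrite -mulrA; apply: prodK_mul => //.
  by case: mP => _ _; apply=> //; apply: PR.
have NM : N = M.
  have [L [tL _ Lu]] := wm.2 P tP.
  by rewrite (seteq_eq (Lu M tM PM)) (seteq_eq (Lu N tN PN)).
exists q; split=> // y Py; rewrite NM in nNq.
have outP u : out M u -> out P u by case=> Ru nMu; split=> // /PM.
have [[u [r [ou Rr e]]]|[u [r [ou Rr e]]]] := dvd_at_total tM pv y q.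
  by exists u, r; split=> //; apply: outP.
exists r, u; split=> //; last by case: ou.
split=> // Pr; apply: nNq; apply/(loc_outP tM); exists u; split=> //.
by rewrite e; apply: prodK_mul.
Qed.

End Separation.

(** * Strongly discrete PvMDs *)

(** The two factors [d a] clear the denominators of [b] and [c], leaving a multiple of [a]. *)
Lemma conductor_transfer (L : fieldType) (u r t d a b c : L) : a != 0 ->
  u * r = t * (d * a * (d * a)) -> u * (r * a^-1 * b * c) = t * (d * b) * (d * c) * a.
Proof. by move=> a0 e; rewrite !mulrA e; field. Qed.

Lemma cancel_generator (L : fieldType) (u a r b t q c : L) : u != 0 -> t != 0 -> q != 0 ->
  u * a = r * b -> t * r = c * q -> q^-1 * a = u^-1 * (c * (t^-1 * b)).
Proof.
move=> u0 t0 q0 e f; have -> : a = r * b / u by rewrite -e mulrAC mulfV ?mul1r.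
have -> : r = c * q / t by rewrite -f mulrAC mulfV ?mul1r.
by field; rewrite u0 t0 q0.
Qed.

Section StronglyDiscrete.
Hypothesis nf : not_field R.
Hypothesis wm : weakly_Matlis R.
Hypothesis sd : strongly_discrete_PvMD R.
Let pv : PvMD R := sd.1.

(* A fractional ideal [L] of a strongly discrete valuation domain is principal over
   [(L : L)]: otherwise [L = Q L] for the prime [Q] of nonunits of [(L : L)], and a
   generator [q] of [Q] over the localization at [Q] would have its inverse in [(L : L)]. *)
Lemma principal_over_endomorphisms M I : t_max M -> nz_submod I ->
  exists a, [/\ I a, a != 0 & forall b c, I b -> I c -> loc I M (a^-1 * b * c)].
Proof.
move=> tM [mI [z [z0 Iz]]]; have mL := loc_submod tM mI; have [L0 LD LM] := mL.
pose E y := forall b, I b -> loc I M (y * b).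
have EL y b : E y -> loc I M b -> loc I M (y * b).
  move=> Ey /(loc_outP tM)[r [or /Ey/(loc_outP tM)[u [ou Iu]]]].
  apply/(loc_outP tM); exists (u * r); split; first exact: outM.
  by rewrite -mulrA [r * _]mulrCA.
have EM x y : E x -> E y -> E (x * y).
  by move=> Ex Ey b Ib; rewrite -mulrA; apply: EL => //; apply: Ey.
have EV x : loc Rs M x -> E x.
  by move=> Vx b Ib; apply: loc_RsetM => //; apply: loc_sub.
have ER x : Rs x -> E x by move=> Rx; apply: EV; apply: loc_sub.
have ED x y : E x -> E y -> E (x + y).
  by move=> Ex Ey b Ib; rewrite mulrDl; apply: LD; [apply: Ex | apply: Ey].
apply: contrapT => none.
have {}none a : I a -> a != 0 -> exists b, I b /\ ~ E (a^-1 * b).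
  move=> Ia a0; apply: contrapT => nob; apply: none; exists a; split=> // b c Ib Ic.
  by apply: contrapT => nL; apply: nob; exists b; split=> // /(_ c Ic).
(* The elements of R that are not units of [E]; 0 is listed apart because its inverse here is 0,
   which lies in [E]. *)
pose Q x := Rs x /\ (x = 0 \/ ~ E x^-1).
have QI a : I a -> a != 0 -> exists u r b, [/\ out M u, Q r, r != 0, I b & u * a = r * b].
  move=> Ia a0; have [b [Ib nE]] := none a Ia a0.
  have [[u [r [ou Rr e]]]|[u [r [ou Rr e]]]] := dvd_at_total tM pv a b; last first.
    case: nE; apply: EV; have -> : a^-1 * b = u^-1 * r.
      by apply: (mulfI (out_neq0 tM ou)); apply: (mulfI a0);
        rewrite mulVKf ?(out_neq0 tM ou) // mulrCA mulVKf // e mulrC.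
    by case: (loc_submod tM (tclosed_submod Rset_tclosed)) => _ _ VM;
      rewrite mulrC; apply: VM => //; apply: out_unit.
  have r0 : r != 0.
    apply: contraNneq a0 => r0; move/eqP: e; rewrite r0 mul0r mulf_eq0.
    by rewrite (negPf (out_neq0 tM ou)).
  exists u, r, b; split=> //; split=> //; right=> Er; apply: nE.
  have -> : a^-1 * b = u * r^-1.
    apply: (mulfI a0); rewrite mulVKf // mulrA [a * u]mulrC e mulrAC mulfV //.
    by rewrite mul1r.
  by apply: EM => //; apply: ER; case: ou.
have QM : sub Q M.
  move=> x [Rx Qx]; apply: contrapT => nMx; have ox : out M x by [].
  case: Qx => [x0|]; first by have := out_neq0 tM ox; rewrite x0 eqxx.
  by apply; apply: EV; apply: out_unit.
have nQ x : Rs x -> ~ Q x -> x != 0 /\ E x^-1.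
  move=> Rx nQx; split; first by apply/eqP => x0; apply: nQx; split=> //; left.
  by apply: contrapT => nE; apply: nQx; split=> //; right.
have QR r x : Rs r -> Q x -> Q (r * x).
  move=> Rr [Rx Qx]; split; first exact: RsetM.
  have [->|r0] := eqVneq r 0; first by left; rewrite mul0r.
  case: Qx => [->|nE]; first by left; rewrite mulr0.
  right=> Erx; apply: nE; have -> : x^-1 = r * (r * x)^-1.
    by rewrite invfM mulrA mulfV // mul1r.
  by apply: EM => //; apply: ER.
have Qdvd x y : Rs x -> Q y -> dvd_at M x y -> Q x.
  move=> Rx Qy [u [r [ou Rr e]]]; have [_ Qux] := QR r y Rr Qy.
  split=> //; rewrite -e in Qux; case: Qux => [/eqP|nE].
    by rewrite mulf_eq0 (negPf (out_neq0 tM ou)) => /eqP; left.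
  right=> Ex; apply: nE; rewrite invfM; apply: EM => //; apply: EV; exact: out_unit.
have pQ : prime_ideal Q.
  split; [split; [split|by move=> x []]| |].
  - by split; [apply: Rset0 | left].
  - move=> x y Qx Qy; have refl v : dvd_at M v v.
      by exists 1, 1; split=> //; [apply: out1 | apply: Rset1].
    have Rxy : Rs (x + y) by apply: RsetD; [case: Qx | case: Qy].
    have [xy|yx] := dvd_at_total tM pv x y.
      by apply: (Qdvd _ y) => //; apply: dvd_atD.
    by apply: (Qdvd _ x) => //; apply: dvd_atD.
  - by move=> r x; apply: QR.
  - by move=> /QM; case: tM.
  - move=> x y Rx Ry [_ Qxy]; apply: contrapT => /not_orP[nQx nQy].
    have [x0 Ex] := nQ x Rx nQx; have [y0 Ey] := nQ y Ry nQy.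
    case: Qxy => [/eqP|]; first by rewrite mulf_eq0 (negPf x0) (negPf y0).
    by rewrite invfM; apply; apply: EM.
have [u0 [r0 [b0 [ou0 Qr0 r00 Ib0 e0]]]] := QI z Iz z0.
have tQ : t_prime Q by apply: (t_prime_intro nf pv tM) => //; exists r0.
have [q [Qq genq]] := t_prime_generator pv wm sd tQ tM QM.
have q0 : q != 0.
  have [t [c [[Rt nQt] Rc e]]] := genq r0 Qr0; have [t0 _] := nQ t Rt nQt.
  apply: contraNneq r00 => q0; move/eqP: e; rewrite q0 mulr0 mulf_eq0.
  by rewrite (negPf t0).
case: Qq => _ [/eqP|]; first by rewrite (negPf q0).
(* It remains to see that [q^-1] lies in [E]: [a = r b / u] with [r] in [Q], and [r = c q / t] with
   [t] invertible in [E]. *)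
apply=> a Ia; have [->|a0] := eqVneq a 0; first by rewrite mulr0.
have [u [r [b [ou Qr rn0 Ib e]]]] := QI a Ia a0.
have [t [c [[Rt nQt] Rc f]]] := genq r Qr; have [t0 Et] := nQ t Rt nQt.
rewrite (cancel_generator (out_neq0 tM ou) t0 q0 e f).
apply: loc_RsetM => //; first exact: out_unit.
by apply: LM => //; apply: Et.
Qed.

(** If [a] generates [I] over its endomorphisms at [M], then [a^-1] is locally in [(E(I) : I)].
    Separation supplies [r] outside [M] with [r a^-1] globally in it, and [a (r a^-1) = r]. *)
Lemma strongly_discrete_w_stable : w_stable R.
Proof.
move=> I [[[mI nI] [d [d0 Rd dI]]] wI]; have [I0 ID IM] := mI.
have mE : submod (Eend I).
  split=> [b Ib|x y Ex Ey b Ib|r x Rr Ex b Ib]; first by rewrite mul0r.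
    by rewrite mulrDl; apply: ID; [apply: Ex | apply: Ey].
  by rewrite -mulrA; apply: IM => //; apply: Ex.
move=> x; split=> [wx b Ib|Ex M tM].
  apply/wI => M tM; apply: (loc_mul tM (A := Eend I) (B := I)) => //.
  - by move=> e c; apply.
  - apply: locS (wx M tM) => //; apply: prodK_sub => // a c Ia Cc.
    by rewrite mulrC; apply: Cc.
  - exact: loc_sub.
have [a [Ia a0 princ]] := principal_over_endomorphisms tM (conj mI nI).
have [||r [or sr]] := t_max_separate nf pv wm tM (h := (d * a) * (d * a)).
- by apply: RsetM; apply: dI.
- by do 2?apply: frac_mul_neq0.
apply/(loc_outP tM); exists r; split=> //.
have -> : r * x = x * a * (r * a^-1) by rewrite mulrACA mulfV // mulr1 mulrC.
apply: prodK_mul; first exact: Ex.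
move=> b Ib c Ic; apply/wI => N tN; have [NM|nNM] := EM (seteq N M).
  rewrite (seteq_eq NM) -!mulrA [a^-1 * _]mulrA.
  have [_ _] := loc_submod tM mI; apply; first by case: or.
  exact: princ.
have [u [t [ou Rt e]]] := sr N tN nNM.
apply/(loc_outP tN); exists u; split=> //.
rewrite (conductor_transfer b c a0 e).
by apply: IM => //; apply: RsetM; [apply: RsetM => //; apply: dI | apply: dI].
Qed.

Lemma t_max_t_prime M : t_max M -> t_prime M.
Proof.
move=> tM; have [_ nM _] := t_max_props tM.
by apply: (t_prime_intro nf pv tM) => //; apply: t_max_prime.
Qed.

(** If [x] is outside [I R_M], then [I R_M] lies in [m x R_M] for a generator [m] of the maximal
    ideal. Some [r / (m x)] with [r] outside [M] is then in [(R : I)], so [x] in [I_v] gives [r / m]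
    in R and [r] in [M]. *)
Lemma strongly_discrete_w_divisorial : w_divisorial R.
Proof.
move=> I [[[mI [z [z0 Iz]]] [d [d0 Rd dI]]] wI] x; split=> [Ix b Rb|vx].
  by rewrite mulrC; apply: Rb.
apply: contrapT => nIx.
have [M [tM nLx]] : exists M, t_max M /\ ~ loc I M x.
  by apply: contrapT => none; apply: nIx; apply/wI => M tM; apply: contrapT => nM;
    apply: none; exists M.
have x0 : x != 0 by apply/eqP => x0; apply: nIx; rewrite x0; case: mI.
have [m [Mm genm]] := t_prime_generator pv wm sd (t_max_t_prime tM) tM (fun y My => My).
have [MR [a [a0 Ma]] _] := t_max_props tM.
have m0 : m != 0.
  have [u [r [ou Rr e]]] := genm a Ma; apply: contraNneq a0 => m0; move/eqP: e.
  by rewrite m0 mulr0 mulf_eq0 (negPf (out_neq0 tM ou)).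
have mx0 : m * x != 0 by apply: frac_mul_neq0.
have Rdx : Rs (d * x) by rewrite mulrC; apply: vx.
have [||r [or sr]] := t_max_separate nf pv wm tM (h := d * x * m).
- by apply: RsetM => //; apply: MR.
- by rewrite -mulrA [x * m]mulrC; apply: frac_mul_neq0.
have Im b : I b -> dvd_at M b (m * x).
  move=> Ib; have [xb|[u [c [ou Rc e]]]] := dvd_at_total tM pv x b.
    by case: nLx; apply: (dvd_at_loc tM mI xb).
  have [Mc|nMc] := EM (M c); last first.
    case: nLx; apply/(loc_outP tM); exists c; rewrite -e; split=> //.
    by case: mI => _ _; apply=> //; case: ou.
  have [v [t [ov Rt f]]] := genm c Mc.
  exists (v * u), t; split=> //; first exact: outM.
  by rewrite -mulrA e mulrA f mulrA.
have transfer (u c e b : K) : u * b = c * e -> e != 0 -> u * (r * e^-1 * b) = c * r.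
  move=> f e0; rewrite -mulrA [u * _]mulrCA [u * _]mulrCA f [e^-1 * _]mulrCA.
  by rewrite mulVf // mulr1 mulrC.
have Rrm : Rs (x * (r * (m * x)^-1)).
  apply: vx => b Ib; apply: Rset_wcl => N tN; apply/(loc_outP tN).
  have [/seteq_eq->|nNM] := EM (seteq N M).
    have [u [c [ou Rc e]]] := Im b Ib; exists u; split=> //.
    rewrite (transfer _ _ _ _ e mx0); apply: RsetM => //; by case: or.
  have [u [t [ou Rt e]]] := sr N tN nNM; exists u; split=> //.
  have -> : u * (r * (m * x)^-1 * b) = t * (d * b).
    rewrite -[r * _ * b]mulrA mulrA e -[d * x * m]mulrA [x * m]mulrC -[t * _ * _]mulrA.
    by rewrite -[d * _ * _]mulrA (mulVKf mx0).
  by apply: RsetM => //; apply: dI.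
case: (or) => _; apply; have [_ _ MM] := t_max_submod tM.
have -> : r = x * (r * (m * x)^-1) * m.
  by rewrite mulrAC [x * m]mulrC mulrCA (mulfV mx0) mulr1.
exact: MM.
Qed.

Lemma strongly_discrete_acc : acc_radical_t R.
Proof.
move=> I rI incI.
have prI n : [/\ sub (I n) Rs, nonzero (I n) & tclosed (I n)].
  by case: (rI n) => /t_idealP.
have mI n : submod (I n) by case: (prI n) => _ _ /tclosed_submod.
have leI n k : (n <= k)%N -> sub (I n) (I k).
  move/subnK => <-; elim: (k - n)%N => [//|i IH] x /IH.
  by rewrite addSn; apply: incI.
have sqI n x : Rs x -> I n (x * x) -> I n x by move=> Rx; apply: (proj2 (rI n) x 2 Rx).
have [_ [a [a0 I0a]] _] := prI 0%N.
pose J x := exists n, I n x.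
have JR x : J x -> Rs x by case=> n; case: (prI n) => + _ _; apply.
have mJ : submod J.
  split; first by exists 0%N; case: (mI 0%N).
    move=> x y [n Ix] [k Iy]; exists (maxn n k); have [_ ID _] := mI (maxn n k).
    by apply: ID; [apply: (leI n) => //; apply: leq_maxl | apply: (leI k) => //; apply: leq_maxr].
  by move=> r x Rr [n Ix]; exists n; case: (mI n) => _ _; apply.
have stab M : t_max M -> exists n, forall y, J y -> loc (I n) M y.
  move=> tM; have [JM|] := EM (sub J M); last first.
    move=> nJM; have [z [[n Iz] nMz]] : exists z, J z /\ ~ M z.
      by apply: contrapT => none; apply: nJM => z Jz; apply: contrapT => nMz; apply: none; exists z.
    exists n => y /JR Ry; apply/(loc_outP tM); exists z.
    split; first by split=> //; apply: JR; exists n.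
    by rewrite mulrC; case: (mI n) => _ _; apply.
  (* The contraction of [J R_M] is prime: if it contains [x y] and [x] is a multiple of [y] at [M],
     it contains [x^2], and the [I n] are radical. *)
  pose P x := Rs x /\ loc J M x.
  have [L0 LD LM] := loc_submod tM mJ.
  have PM : sub P M.
    move=> x [Rx /(loc_outP tM)[u [[Ru nMu] /JM Mux]]].
    by case: (t_max_prime tM) => _ _ /(_ u x Ru Rx Mux)[].
  have sqP x y : Rs x -> dvd_at M x y -> loc J M (x * y) -> P x.
    move=> Rx [u [c [ou Rc e]]] Jxy; split=> //.
    have /(loc_outP tM)[v [ov [n Iv]]] : loc J M (x * x).
      apply: locK => //; apply/(loc_outP tM); exists u; split=> //.
      by rewrite mulrA e -mulrA [y * x]mulrC; apply: LM.
    apply/(loc_outP tM); exists v; split=> //; exists n; apply: sqI.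
      by apply: RsetM => //; case: ov.
    by rewrite mulrACA -mulrA; case: (mI n) => _ _; apply=> //; case: ov.
  have pP : prime_ideal P.
    split; [split; [split|by move=> x []]| |].
    - by split=> //; apply: Rset0.
    - by move=> x y [Rx Lx] [Ry Ly]; split; [apply: RsetD | apply: LD].
    - by move=> r x Rr [Rx Lx]; split; [apply: RsetM | apply: LM].
    - by move=> /PM; case: tM.
    - move=> x y Rx Ry [_ Jxy].
      have [xy|yx] := dvd_at_total tM pv x y; [left | right].
        exact: (sqP x y).
      by apply: (sqP y x) => //; rewrite mulrC.
  have JP x : J x -> P x by move=> Jx; split; [apply: JR | apply: loc_sub].
  have tP : t_prime P.
    apply: (t_prime_intro nf pv tM) => //; exists a; split=> //.
    by apply: JP; exists 0%N.
  have [q [[Rq /(loc_outP tM)[t [ot [n Itq]]]] genq]] := t_prime_generator pv wm sd tP tM PM.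
  exists n => y Jy; have [s [c [[Rs' nPs] Rc f]]] := genq y (JP y Jy).
  (* [q] generates [P] only after inverting elements such as [s]. But [y] is a multiple of [s] at
     [M], so [y^2] is a multiple of [s y = c q], and radicality recovers [y]. *)
  have [[e [b [oe Rb g]]]|[e [b [[Re nMe] Rb g]]]] := dvd_at_total tM pv y s; last first.
    case: pP => [[[_ _ PRM] _] _ PP].
    by case: (PP e s) => [//|//| |/PM //|//]; rewrite g; apply: PRM => //; apply: JP.
  apply/(loc_outP tM); exists (t * e); split; first exact: outM.
  have [Rt _] := ot; have [Re _] := oe; have Ry := JR y Jy.
  apply: sqI; first by do 2?apply: RsetM.
  have -> : t * e * y * (t * e * y) = t * e * (b * c) * (t * q).
    rewrite -!mulrA; congr (t * _); congr (e * _).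
    rewrite [y * _]mulrCA [RHS]mulrA [RHS]mulrCA; congr (t * _).
    by rewrite [y * (e * y)]mulrCA mulrA g -!mulrA f.
  by case: (mI n) => _ _; apply=> //; do 2?[apply: RsetM].
have [||||n [_ stabn]] := @finite_select nat (fun=> True)
  (fun N n => forall y, J y -> loc (I n) N y) a.
- by apply: wm.1 => //; apply: JR; exists 0%N.
- by exists 0%N.
- move=> n k _ _; exists (maxn n k); split=> // N tN [] LN y /LN; apply: locS => //; apply: leI.
    exact: leq_maxl.
  exact: leq_maxr.
- by move=> N tN _; have [n ?] := stab N tN; exists n.
exists n => k nk x; split=> [Ix|]; last exact: leI.
have [_ nIn cIn] := prI n; apply: wcl_tclosed => // N tN.
have Jx : J x by exists k.
have [Na|nNa] := EM (N a); first exact: stabn.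
apply/(loc_outP tN); exists a; split; first by split=> //; apply: JR; exists 0%N.
by rewrite mulrC; case: (mI n) => _ _; apply; [apply: JR | apply: (leI 0%N)].
Qed.

End StronglyDiscrete.
(** * w-divisorial domains *)

Section WDivisorial.
Hypothesis wd : w_divisorial R.

(** The bound [x] makes the intersection a fractional ideal, so that [w_divisorial] applies. *)
Definition bounded_at (S : subK R -> Prop) x : subK R :=
  fun y => Rs (x * y) /\ forall N, t_max N -> S N -> loc Rs N y.

Lemma bounded_at1 S x : Rs x -> bounded_at S x 1.
Proof.
move=> Rx; split=> [|N tN _]; first by rewrite mulr1.
by apply: loc_sub => //; apply: Rset1.
Qed.

Lemma bounded_at_w_ideal S x : Rs x -> x != 0 -> w_ideal (bounded_at S x).
Proof.
move=> Rx x0; split; last first.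
  move=> y; split=> [|wy]; first exact: wcl_sub.
  split=> [|N tN SN].
    apply: Rset_wcl => M tM; have /(loc_outP tM)[u [ou [Rxuy _]]] := wy M tM.
    by apply/(loc_outP tM); exists u; rewrite mulrCA.
  by apply: locK => //; apply: locS (wy N tN) => // e [_ /(_ N tN SN)].
split; last by exists x; split=> // y [].
split; last by exists 1; split; [apply: oner_neq0 | apply: bounded_at1].
have mR := tclosed_submod Rset_tclosed.
split.
- split=> [|N tN _]; first by rewrite mulr0; apply: Rset0.
  by have [] := loc_submod tN mR.
- move=> y z [Ry Ly] [Rz Lz]; split=> [|N tN SN]; first by rewrite mulrDr; exact: RsetD.
  have [_ LD _] := loc_submod tN mR.
  by apply: LD; [apply: Ly | apply: Lz].
- move=> r y Rr [Ry Ly]; split=> [|N tN SN]; first by rewrite mulrCA; apply: RsetM.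
  by have [_ _ LM] := loc_submod tN mR; apply: LM => //; apply: Ly.
Qed.

(* Divisoriality turns an intersection of the modules [bounded_at S x] equal to [R] into
   a sum of their duals with t-closure [R]. *)
Lemma bounded_at_dual (C : (subK R -> Prop) -> Prop) x : Rs x -> x != 0 -> (exists S, C S) ->
  (forall y, (forall S, C S -> bounded_at S x y) -> Rs y) ->
  tclosure (fun g => exists S, C S /\ colon Rs (bounded_at S x) g) 1.
Proof.
move=> Rx x0 [S0 CS0] capR; set G := fun g => _.
have GR : sub G Rs.
  by move=> g [S [_ /(_ 1)]]; rewrite mulr1; apply; apply: bounded_at1.
have tT : t_ideal (tclosure G).
  apply/t_idealP; split; last exact: tclosureK.
    by move=> g /(tclosureS GR) /Rset_tclosed.
  exists x; split=> //; apply: tclosure_sub; exists S0; split=> // y [].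
  by [].
apply/(wd (t_ideal_w_ideal tT)) => b Tb; rewrite mul1r; apply: capR => S CS.
apply/(wd (bounded_at_w_ideal S Rx x0)) => c Sc.
by apply: Tb; apply: tclosure_sub; exists S.
Qed.

Lemma w_divisorial_finite_t_char x : Rs x -> x != 0 -> finite_t_char x.
Proof.
move=> Rx x0; have [[M0 [tM0 M0x]]|none] := EM (exists M, t_max M /\ M x); last first.
  by exists 0%N, (fun=> Rs) => M tM Mx; case: none; exists M.
have [||s [sG s1]] := @bounded_at_dual
  (fun S => exists M, [/\ t_max M, M x & S = eq M]) x Rx x0.
- by exists (eq M0), M0.
- move=> y Cy; have [Rxy _] := Cy _ (ex_intro _ M0 (And3 tM0 M0x erefl)).
  apply: Rset_wcl => M tM; have [Mx|nMx] := EM (M x).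
    by have [_ /(_ M tM erefl)] := Cy _ (ex_intro _ M (And3 tM Mx erefl)).
  by apply/(loc_outP tM); exists x.
have /choice[f fP] : forall g, exists M, g \in s ->
    t_max M /\ colon Rs (bounded_at (eq M) x) g.
  move=> g; have [sg|] := boolP (g \in s); last by exists Rs.
  by have [_ [[M [tM _ ->]] cg]] := sG g sg; exists M.
exists (size s), (fun i => f (s`_i)) => N tN Nx; apply: contrapT => none.
(* For an unlisted [N], pick [h g] in [N] outside [f g]. Any [y] carrying [x] and all [h g] into R
   lies in each [bounded_at (eq (f g)) x], so 1 falls into the t-closure of a finite subset of
   [N]. *)
have /choice[h hP] : forall g, exists r, g \in s -> [/\ Rs r, N r & ~ f g r].
  move=> g; have [sg|] := boolP (g \in s); last by exists 0.
  have [tf _] := fP g sg; have [|r ?] := @t_max_not_sub (f g) N tf tN; last by exists r.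
  move=> Nf; apply: none; exists (index g s).
  by rewrite index_mem nth_index.
have [_ _ cN] := t_max_props tN.
case: tN => _ + _; apply; apply: cN; exists (x :: [seq h g | g <- s]); split.
  by move=> a; rewrite inE => /orP[/eqP-> //|/mapP[g /hP[] + + + ->]].
move=> y ys; apply: s1 => g sg; have [tf cg] := fP g sg; have [Rh Nh nfh] := hP g sg.
rewrite mulrC; apply: cg; split; first by rewrite mulrC; apply: ys; apply: mem_head.
move=> _ _ <-; apply/(loc_outP tf); exists (h g); split=> //.
by rewrite mulrC; apply: ys; rewrite inE map_f ?orbT.
Qed.

Lemma w_divisorial_unique_t_max P M N : PvMD R -> t_prime P -> t_max M -> t_max N ->
  sub P M -> sub P N -> seteq N M.
Proof.
move=> pv tP tM tN PM PN; apply: contrapT => nNM.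
have [tiP _] := t_prime_ideal tP; have [PR [x [x0 Px]] cP] := proj1 (t_idealP P) tiP.
have Rx := PR x Px; case: (tP) => [[[[_ _ PRM] _] _ PP] _].
have /= := @bounded_at_dual (fun S => S = eq M \/ S = fun L => ~ seteq L M) x Rx x0.
case; first by exists (eq M); left.
  move=> y Cy; apply: Rset_wcl => L tL; have [/seteq_eq LM|nLM] := EM (seteq L M).
    by have [_ /(_ L tL (esym LM))] := Cy _ (or_introl erefl).
  by have [_ /(_ L tL nLM)] := Cy _ (or_intror erefl).
move=> s [sG s1]; have [g [[S [CS cg]] nMg]] : exists g,
    (exists S, (S = eq M \/ S = fun L => ~ seteq L M) /\ colon Rs (bounded_at S x) g) /\ ~ M g.
  apply: contrapT => none; have [_ _ cM] := t_max_props tM.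
  case: (tM) => _ + _; apply; apply: cM; exists s; split=> // g /sG Gg.
  by apply: contrapT => nMg; apply: none; exists g.
have Rg : Rs g by rewrite -[g]mulr1; apply: cg; apply: bounded_at1.
case: CS => eS; rewrite {}eS {S} in cg.
  (* Case [S = {M}]: as [g r] is outside [P], [x] is a multiple of it at [N]. So some [e / (g r)]
     with [e] outside [N] lies in the module, and multiplying by [g] gives [e] in [r R], inside
     [N]. *)
  have [r [Rr Nr nMr]] := t_max_not_sub tM tN nNM.
  have ogr : out M (g * r) by apply: outM.
  have gr0 := out_neq0 tM ogr; have r0 : r != 0 by apply: (out_neq0 tM).
  have [[e [c [oe Rc f]]]|[e [c [[Re nNe] Rc f]]]] := dvd_at_total tN pv x (g * r); last first.
    have [||||/PM] := PP e (g * r) => //; first by case: ogr.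
    - by rewrite f; apply: PRM.
    - by move/PN.
    - by case: ogr.
  have [Re nNe] := oe; apply: nNe.
  have -> : e = g * (e * (g * r)^-1) * r by rewrite mulrAC mulrCA mulfV ?mulr1.
  case: (t_max_submod tN) => _ _; apply=> //; apply: cg; split.
    by rewrite mulrA [x * e]mulrC f mulfK.
  move=> _ _ <-; apply/(loc_outP tM); exists (g * r); split=> //.
  by rewrite mulrCA mulfV ?mulr1.
(* Case of the complement: the finite list [u] in [M] has an entry outside each [L != M] containing
   [x], which puts [g] into the t-closure of [x :: u], inside [M]. *)
have [||||u [uM usep]] := @finite_select (seq K) (fun u => forall a, a \in u -> M a)
  (fun L u => ~ seteq L M -> exists r, r \in u /\ out L r) x.
- exact: w_divisorial_finite_t_char.
- by exists [::].
- move=> u v uM vM; exists (u ++ v); split=> [a|L tL].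
    by rewrite mem_cat => /orP[/uM|/vM].
  by case=> sep /sep[r [ur or]]; exists r; rewrite mem_cat ur ?orbT.
- move=> L tL Lx; have [LM|nLM] := EM (seteq L M); first by exists [::].
  have [|r [Rr Mr nLr]] := t_max_not_sub tL tM.
    by move=> /seteq_eq ML; apply: nLM; rewrite ML.
  by exists [:: r]; split=> [a|_]; [rewrite inE => /eqP-> | exists r; rewrite inE eqxx].
have [_ _ cM] := t_max_props tM; apply: nMg; apply: cM; exists (x :: u); split.
  by move=> a; rewrite inE => /orP[/eqP->|/uM //]; apply: PM.
move=> y ys; have Rxy : Rs (x * y) by rewrite mulrC; apply: ys; apply: mem_head.
apply: cg; split=> // L tL nLM; apply/(loc_outP tL).
have [Lx|nLx] := EM (L x); last by exists x.
have [r [ur or]] := usep L tL Lx nLM; exists r; split=> //.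
by rewrite mulrC; apply: ys; rewrite inE ur orbT.
Qed.

Lemma w_divisorial_weakly_Matlis : PvMD R -> weakly_Matlis R.
Proof.
move=> pv; split; first exact: w_divisorial_finite_t_char.
move=> P tP; have [tiP pP] := t_prime_ideal tP; have [M [tM PM]] := t_max_exists tiP pP.
by exists M; split=> // N tN PN; apply: (w_divisorial_unique_t_max pv tP).
Qed.

End WDivisorial.
(** Multiplication by [z] acts on the vector (1, x) as the matrix with rows (a, b) and (c, d); the
    witness is its characteristic polynomial. *)
Lemma eigenvalue2_integral (A : comNzRingType) (L : fieldType) (f : {rmorphism A -> L})
    (a b c d : A) (x z : L) : z - f a = f b * x -> x * (z - f d) = f c ->
  exists p, p \is monic /\ root (map_poly f p) z.
Proof.
move=> e1 e2; exists (('X - a%:P) * ('X - d%:P) - (b * c)%:P); split.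
  rewrite monicE lead_coefDl; first by rewrite -monicE monicMl ?monicXsubC.
  rewrite size_polyN (leq_ltn_trans (size_polyC_leq1 _)) //.
  by rewrite size_Mmonic ?monicXsubC ?polyXsubC_eq0 ?size_XsubC.
rewrite rootE rmorphB rmorphM !rmorphB /= map_polyX !map_polyC /= !hornerE.
by rewrite e1 -mulrA e2 rmorphM subrr.
Qed.

(** * w-stable domains *)

Lemma w_stable_strongly_discrete : not_field R -> PvMD R -> w_stable R -> strongly_discrete_PvMD R.
Proof.
move=> nf pv ws; split=> // P tP P2.
have [tiP pP] := t_prime_ideal tP; have [PR [z [z0 Pz]] cP] := proj1 (t_idealP P) tiP.
have [P0 PD PM] := tclosed_submod cP.
have [M [tM PsM]] := t_max_exists tiP pP.
set C := colon (Eend P) P.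
have mC : submod C.
  split=> [b Pb c Pc|x y Cx Cy b Pb c Pc|r x Rr Cx b Pb c Pc]; first by rewrite !mul0r.
    by rewrite !mulrDl; apply: PD; [apply: Cx | apply: Cy].
  by rewrite -!mulrA; apply: PM => //; rewrite mulrA; apply: Cx.
have /(ws P (t_ideal_w_ideal tiP)) /(_ M tM) /(loc_outP tM) : Eend P 1.
  by move=> b; rewrite mul1r.
move=> [u [ou]]; rewrite mulr1 => -[s [sPC us]].
have [a [sa [v [ov vs]]]] := fin_principal_at tM [seq p.1 | p <- s] pv.
have Pa : P a by case: sa => [->//|/mapP[p /sPC[Pp _] ->]].
(* With the first factors all multiples of [a] at [M], the sum collapses to one product. *)
have [q [Cq vu]] : exists q, C q /\ v * u = q * a.
  have [C0 CD CM] := mC; rewrite us mulr_sumr big_seq.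
  apply: (@submod_sum (fun y => exists q, C q /\ y = q * a)).
    split; first by exists 0; rewrite mul0r.
      move=> _ _ [q [Cq ->]] [t [Ct ->]]; exists (q + t); rewrite mulrDl.
      by split=> //; apply: CD.
    by move=> r _ Rr [q [Cq ->]]; exists (r * q); rewrite mulrA; split=> //; apply: CM.
  move=> p sp; have [r Rr e] := vs p.1 (map_f _ sp); have [_ Cp] := sPC p sp.
  by exists (r * p.2); split; [apply: CM | rewrite mulrA e mulrAC].
have ow := outM tM ov ou; rewrite vu in ow; set w := q * a in ow.
have a0 : a != 0 by have := out_neq0 tM ow; rewrite mulf_eq0 => /norP[].
have P2a y : prodK P P y -> exists2 p, P p & w * y = a * p.
  apply: (prodK_sub (E := fun y => exists2 p, P p & w * y = a * p)) => [|b c Pb Pc]; last first.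
    by exists (q * b * c); [apply: Cq | rewrite [w]mulrC -!mulrA].
  split; first by exists 0; rewrite ?mulr0.
    by move=> x t [p Pp e] [p' Pp' f]; exists (p + p'); [apply: PD | rewrite !mulrDr e f].
  by move=> r x Rr [p Pp e]; exists (r * p); [apply: PM | rewrite mulrCA e mulrCA].
have nP2 : nz_submod (prodK P P).
  split; first exact: prodK_submod.
  by exists (z * z); split; [apply: frac_mul_neq0 | apply: prodK_mul].
(* Since [P = (P^2)_t], [a] lies in [P^2 R_M]; cancelling [a] puts [w * e] into [P]. *)
have /(tcl_tclosure nP2) cPPa : tcl (prodK P P) a by apply/P2.
have /(loc_outP tM)[e [oe /P2a[p Pp f]]] := tclosure_loc tM nf pv (proj1 nP2) cPPa.
have [_ nMwe] := outM tM ow oe; apply: nMwe; apply: PsM.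
by rewrite (_ : w * e = p) //; apply: (mulfI a0); rewrite -f mulrC mulrA.
Qed.

Lemma integrally_closed_w_stable_PvMD : integrally_closed R -> w_stable R -> PvMD R.
Proof.
move=> ic ws M tM x x0.
pose J : subK R := fun y => exists p q, [/\ Rs p, Rs q & y = p + q * x].
have mJ : submod J.
  split; first by exists 0, 0; rewrite mul0r addr0; split=> //; apply: Rset0.
    move=> _ _ [p [q [Rp Rq ->]]] [p' [q' [Rp' Rq' ->]]]; exists (p + p'), (q + q').
    by rewrite mulrDl addrACA; split=> //; apply: RsetD.
  move=> r _ Rr [p [q [Rp Rq ->]]]; exists (r * p), (r * q).
  by rewrite mulrDr mulrA; split=> //; apply: RsetM.
have J1 : J 1 by exists 1, 0; rewrite mul0r addr0; split=> //; [apply: Rset1 | apply: Rset0].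
have Jx : J x by exists 0, 1; rewrite mul1r add0r; split=> //; [apply: Rset0 | apply: Rset1].
have [I1 Ix] : wcl J 1 /\ wcl J x by split; apply: wcl_sub.
have wI : w_ideal (wcl J).
  split; last by move=> y; split; [apply: wcl_sub | apply: wclK].
  split; first by split; [apply: wcl_submod | exists 1; rewrite oner_neq0].
  have [d [d0 Rd Rdx]] := denominator x; exists d; split=> // y wy.
  apply: Rset_wcl => N tN; have /(loc_outP tN)[r [or [p [q [Rp Rq e]]]]] := wy N tN.
  apply/(loc_outP tN); exists r; split=> //.
  by rewrite mulrCA e mulrDr mulrCA; apply: RsetD; apply: RsetM.
(* [y] sends [1] and [x] into the localization of [J]: a multiple [r * y] by some [r]
   outside [N] is an eigenvalue of a 2x2 matrix over [R]. *)
have ER y : Eend (wcl J) y -> Rs y.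
  move=> Ey; apply: Rset_wcl => N tN.
  have := Ey 1 I1 N tN; rewrite mulr1 => /(loc_outP tN)[r [or [p [q [Rp Rq e]]]]].
  have /(loc_outP tN)[u [ou [p' [q' [Rp' Rq' f]]]]] := Ey x Ix N tN.
  apply/(loc_outP tN); exists (r * u); split; first exact: outM.
  have [[Rr _] [Ru _]] := (or, ou).
  have [a ea] := RsetM Ru Rp; have [b eb] := RsetM Ru Rq.
  have [c ec] := RsetM Rr Rp'; have [d ed] := RsetM Rr Rq'.
  have e1 : r * u * y - F a = F b * x.
    by rewrite -ea -eb mulrAC [_ * u]mulrC e mulrDr mulrA addrC addKr.
  have e2 : x * (r * u * y - F d) = F c.
    rewrite mulrBr -ec -ed -!mulrA mulrCA [x * _]mulrCA [x * y]mulrC f.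
    by rewrite mulrDr [x * _]mulrCA [x * _]mulrC addrK.
  by apply: ic; apply: (eigenvalue2_integral e1 e2).
have /(ws _ wI) /(_ M tM) /(loc_outP tM) : Eend (wcl J) 1 by move=> b; rewrite mul1r.
move=> [r [or]]; rewrite mulr1 => -[s [sIC er]].
have [a [b [Ia Cb nMab]]] : exists a b, [/\ wcl J a, colon (Eend (wcl J)) (wcl J) b & ~ M (a * b)].
  apply: contrapT => none; case: (or) => _; apply; rewrite er big_seq.
  apply: (submod_sum _ (t_max_submod tM)) => p /sIC[Ip Cp].
  by apply: contrapT => nMp; apply: none; exists p.1, p.2.
have Rb c : wcl J c -> Rs (b * c) by move=> Ic; apply: ER; apply: Cb.
have /(loc_outP tM)[t [ot [p [q [Rp Rq e]]]]] := Ia M tM.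
have Rb1 : Rs b by rewrite -[b]mulr1; apply: Rb.
have Rbx := Rb x Ix.
(* [b] and [b * x] are not both in [M], since [t * (a * b)] is a combination of them; the one
   outside is a denominator for [x] or [x^-1]. *)
have [Mb|nMb] := EM (M b); last first.
  by left; apply/(loc_outP tM); exists b.
right; apply/(loc_outP tM); exists (b * x); rewrite mulfK //; split=> //; split=> // Mbx.
have oab : out M (a * b) by split=> //; rewrite mulrC; apply: Rb.
have [_] := outM tM ot oab; apply; rewrite mulrA e mulrDl -mulrA [x * b]mulrC.
by case: (t_max_submod tM) => _ MD MM; apply: MD; apply: MM.
Qed.

(** If [x^-1] is in [R_M], dividing a monic equation of degree [n.+1] by [x ^+ n] expresses [x]
    through powers of [x^-1]. *)
Lemma PvMD_integrally_closed : PvMD R -> integrally_closed R.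
Proof.
move=> pv x [p [mp rx]]; apply: Rset_wcl => M tM.
have mV := loc_submod tM (tclosed_submod Rset_tclosed); have [_ _ VM] := mV.
have [x0|x0] := eqVneq x 0; first by rewrite x0; case: mV.
have [//|Vx] := pv M tM x x0.
have Vxn n : loc Rs M (x^-1 ^+ n).
  elim: n => [|n IH]; first by rewrite expr0; apply: loc_sub => //; apply: Rset1.
  by rewrite exprS; apply: loc_mul Vx IH => //; apply: RsetM.
move: rx; rewrite rootE (@horner_coef_wide _ (size p)) ?size_poly //.
have := monic_neq0 mp; rewrite -size_poly_gt0; move: mp; rewrite monicE lead_coefE.
case: (size p) => [//|[|n]] /= /eqP lp _.
  by rewrite big_ord1 coef_map /= lp rmorph1 mulr1 oner_eq0.
rewrite big_ord_recr coef_map /= lp rmorph1 mul1r addrC addr_eq0 => /eqP e.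
have -> : x = x ^+ n.+1 * x^-1 ^+ n by rewrite exprS exprVn mulfK // expf_neq0.
rewrite e mulNr -mulN1r; apply: (VM); first by apply: RsetN; apply: Rset1.
rewrite mulr_suml; apply: submod_sum => // i _; rewrite coef_map -mulrA.
apply: VM; first by exists p`_i.
have -> : x^-1 ^+ n = x^-1 ^+ i * x^-1 ^+ (n - i) by rewrite -exprD subnKC // -ltnS.
by rewrite mulrA -exprMn mulfV // expr1n mul1r.
Qed.

End StarOperations.

(** * The equivalence of the six conditions *)

Theorem theorem2p7 (R : idomainType) (hK : not_field R) :
  let i   := [/\ integrally_closed R, w_divisorial R & w_stable R] in
  let ii  := [/\ w_stable R, w_divisorial R & PvMD R] in
  let iii := w_divisorial R /\ generalized_Krull R in
  let iv  := [/\ weakly_Matlis R, w_stable R & PvMD R] in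
  let v   := weakly_Matlis R /\ strongly_discrete_PvMD R in
  let vi  := weakly_Matlis R /\ generalized_Krull R in
  [/\ i <-> ii, ii <-> iii, iii <-> iv, iv <-> v & v <-> vi].
Proof.
move=> i ii iii iv v vi.
have i_ii : i -> ii by case=> ic wd ws; split=> //; apply: integrally_closed_w_stable_PvMD.
have ii_i : ii -> i by case=> ws wd pv; split=> //; apply: PvMD_integrally_closed.
have v_vi : v -> vi by case=> wm sd; split=> //; split=> //; apply: strongly_discrete_acc.
have vi_v : vi -> v by case=> wm [sd _].
(* Condition (v) is the hub: it yields (iii) and (iv), and each leads back to it. *)
have v_iii : v -> iii.
  move=> vR; have [[wm gk] [_ sd]] := (v_vi vR, vR).
  by split=> //; apply: strongly_discrete_w_divisorial.
have iii_v : iii -> v.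
  by case=> wd [sd _]; split=> //; apply: w_divisorial_weakly_Matlis => //; case: sd.
have v_iv : v -> iv by case=> wm sd; split=> //; [apply: strongly_discrete_w_stable | case: sd].
have iv_v : iv -> v by case=> wm ws pv; split=> //; apply: w_stable_strongly_discrete.
have iii_ii : iii -> ii.
  by move=> iiiR; have [_ ws pv] := v_iv (iii_v iiiR); case: iiiR.
have ii_iii : ii -> iii.
  case=> ws wd pv; apply: v_iii; split; first exact: w_divisorial_weakly_Matlis.
  exact: w_stable_strongly_discrete.
have iii_iv h : iv := v_iv (iii_v h); have iv_iii h : iii := v_iii (iv_v h).
exact: And5 (conj i_ii ii_i) (conj ii_iii iii_ii) (conj iii_iv iv_iii) (conj iv_v v_iv)
  (conj v_vi vi_v).
Qed.
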